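(* Let $\mathcal{P}=(p_k)_{k\in\mathbb{N}_0}$ be a sequence of natural numbers $p_k\ge2$, let $(V_n)_{n\in\mathbb{N}_0}$ be the associated Vilenkin system on $[0,1)$, and consider the subsystem of the Vilenkin system with indices in a set $A\subset\mathbb{N}_0$. For $A'\subset A$ and $N\in\mathbb{N}$ write $A'\cap B_N=\{n\in A' : 0\le n<P_N\}$ and $$F_{A'}^N=\bigl\{x\in[0,1) : V_n(x)=1\ \text{for all } n\in A'\cap B_N\bigr\}.$$ If the subsystem $\{V_n : n\in A\}$ is an $\alpha$-Sidon system for some $1\le\alpha<2$, then there is a constant $C>0$, not depending on $N$ or $A'$, such that for every nonempty subset $A'\subset A$ and every $N$, $$|A'\cap B_N|\le C\left(\log\left(\frac{1}{\mu(F_{A'}^N)}\right)\right)^{\frac{\alpha}{2-\alpha}},$$ where $\mu$ is Lebesgue measure on $[0,1)$.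
   Context: $\mathbb{N}_0=\{0,1,2,\ldots\}$. Put $P_0=1$ and $P_k=\prod_{j=0}^{k-1}p_j$ for $k\ge1$. Each $x\in[0,1)$ is written $x=\sum_{k=0}^\infty g_k/P_{k+1}$ with digits $g_k\in\{0,\ldots,p_k-1\}$ (uniquely up to a countable set of $x$; this identifies $[0,1)$, up to a countable set, with the group $\prod_{k=0}^\infty\mathbb{Z}_{p_k}$). The generalized Rademacher functions are $R_k(x)=\exp(2\pi i g_k/p_k)$, and the Vilenkin functions are $V_0\equiv1$, $V_n=\prod_{k=0}^\infty R_k^{n_k}$ for $n\ge1$, where $n=\sum_kn_kP_k$ with $n_k\in\{0,\ldots,p_k-1\}$. $B_N$ stands for the first $P_N$ Vilenkin functions $V_n$, $0\le n<P_N$, identified with their indices. $|\cdot|$ applied to a set denotes cardinality. The subsystem $\{V_n:n\in A\}$ is called $\alpha$-Sidon if there is a constant $C_1>0$ such that for every finite sum $\sum_{n}c_nV_n$ with $n\in A$ and $c_n\in\mathbb{C}$, $\bigl(\sum_n|c_n|^\alpha\bigr)^{1/\alpha}\le C_1\bigl\|\sum_nc_nV_n\bigr\|_{L_\infty}$.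
   Formalization: The case A'∩B_N = {0} is excluded: there V_0 = 1 gives F = [0,1), so the logarithm is 0 and the claimed bound would read 1 ≤ 0 (e.g. A = A' = {0}, which is α-Sidon). *)

(* Defs.v *)
From HB Require Import structures.
From mathcomp Require Export all_boot all_order all_algebra finmap.
From mathcomp Require Export complex.
From mathcomp Require Export all_classical all_reals all_analysis.

Set Implicit Arguments.
Unset Strict Implicit.
Unset Printing Implicit Defensive.

Import Order.TTheory GRing.Theory Num.Theory.
Import numFieldNormedType.Exports.

Local Open Scope classical_set_scope.
Local Open Scope ring_scope.

Definition vprod (p : nat -> nat) (k : nat) : nat := (\prod_(j < k) p j)%N.

Definition ndigit (p : nat -> nat) (n k : nat) : nat :=
  ((n %/ vprod p k) %% p k)%N.

(* At the countably many points with two expansions, this selects the digits of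
   the terminating one. *)
Definition xdigit (R : realType) (p : nat -> nat) (x : R) (k : nat) : nat :=
  (Num.truncn ((vprod p k.+1)%:R * x) %% p k)%N.

Lemma vprodS (p : nat -> nat) (k : nat) : vprod p k.+1 = (vprod p k * p k)%N.
Proof. by rewrite /vprod big_ord_recr. Qed.

Lemma ltn_vprod (p : nat -> nat) (p2 : forall k, (1 < p k)%N) (n : nat) :
  (n < vprod p n)%N.
Proof.
elim: n => [|n IH]; first by rewrite /vprod big_ord0.
rewrite vprodS; apply: (@leq_trans (n.+1 * 2)).
  by rewrite muln2 -addnn addSn addnS !ltnS leq_addr.
exact: leq_mul.
Qed.

Lemma vprod_gt0 (p : nat -> nat) (p2 : forall k, (1 < p k)%N) (n : nat) :
  (0 < vprod p n)%N.
Proof. exact: leq_ltn_trans (ltn_vprod p2 n). Qed.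

Lemma ndigit_sum (p : nat -> nat) (p2 : forall k, (1 < p k)%N) (n : nat) :
  n = (\sum_(k < n) ndigit p n k * vprod p k)%N.
Proof.
suff H K : (\sum_(k < K) ndigit p n k * vprod p k = n %% vprod p K)%N.
  by rewrite H modn_small // ltn_vprod.
elim: K => [|K IH]; first by rewrite big_ord0 /vprod big_ord0 modn1.
rewrite big_ord_recr /= IH /ndigit vprodS.
have P0 := vprod_gt0 p2 K.
have p0 : (0 < p K)%N by exact: ltnW.
have h1 : (n %/ vprod p K %% p K < p K)%N by rewrite ltn_pmod.
have h2 : (n %% vprod p K < vprod p K)%N by rewrite ltn_pmod.
set d := (n %/ vprod p K %% p K)%N in h1 *.
set r := (n %% vprod p K)%N in h2 *.
have lt : (r + d * vprod p K < vprod p K * p K)%N.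
  apply: (@leq_trans (d.+1 * vprod p K)); first by rewrite mulSn ltn_add2r.
  by rewrite mulnC leq_mul2l h1 orbT.
have e : n = (n %/ vprod p K %/ p K * (vprod p K * p K) + (r + d * vprod p K))%N.
  rewrite {1}(divn_eq n (vprod p K)) {1}(divn_eq (n %/ vprod p K) (p K)).
  by rewrite -/r -/d mulnDl (mulnC (vprod p K) (p K)) mulnA -addnA (addnC r).
by rewrite e modnMDl modn_small.
Qed.

Lemma xdigit_lt (R : realType) (p : nat -> nat) (p2 : forall k, (1 < p k)%N)
  (x : R) (k : nat) : (xdigit p x k < p k)%N.
Proof. by rewrite ltn_pmod // ltnW. Qed.

Lemma xdigit_series (R : realType) (p : nat -> nat)
    (p2 : forall k, (1 < p k)%N) (x : R) (hx : x \in `[0, 1[) :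
  series (fun k => (xdigit p x k)%:R / (vprod p k.+1)%:R) @ \oo --> x.
Proof.
move: hx; rewrite in_itv /= => /andP[x0 x1].
have Pp K : 0 < (vprod p K)%:R :> R by rewrite ltr0n vprod_gt0.
have tdiv K : Num.truncn ((vprod p K)%:R * x) =
    (Num.truncn ((vprod p K.+1)%:R * x) %/ p K)%N.
  have y0 : 0 <= (vprod p K.+1)%:R * x by rewrite mulr_ge0.
  have /andP[l u] := truncn_itv y0.
  have pK : (0 < p K)%N by exact: ltnW.
  have pR : 0 < (p K)%:R :> R by rewrite ltr0n.
  apply: truncn_def; move: l u; set t := Num.truncn _ => l u.
  have e : (vprod p K.+1)%:R * x = (p K)%:R * ((vprod p K)%:R * x).
    by rewrite vprodS natrM mulrA (mulrC (p K)%:R).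
  rewrite -(ler_pM2l pR) -(ltr_pM2l pR) -e -!natrM; apply/andP; split.
    by apply: le_trans l; rewrite ler_nat mulnC leq_divM.
  apply: lt_le_trans u _; rewrite ler_nat mulnC.
  by rewrite ltn_ceil.
have sE K : series (fun k => (xdigit p x k)%:R / (vprod p k.+1)%:R) K =
    (Num.truncn ((vprod p K)%:R * x))%:R / (vprod p K)%:R :> R.
  elim: K => [|K IH].
    rewrite /series /= big_geq // /vprod big_ord0 mul1r divr1.
    by rewrite (@truncn_def _ x 0) // x0.
  rewrite seriesS IH tdiv /xdigit.
  set t := Num.truncn ((vprod p K.+1)%:R * x).
  have -> : (t %/ p K)%:R / (vprod p K)%:R =
      ((t %/ p K) * p K)%:R / (vprod p K.+1)%:R :> R.
    rewrite vprodS !natrM -mulf_div divff ?mulr1 //.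
    by rewrite pnatr_eq0 -lt0n ltnW.
  by rewrite -mulrDl -natrD addnC -divn_eq.
apply: (@squeeze_cvgr _ _ _ _ (fun K => x - K.+1%:R^-1) (fun=> x)).
- apply: nearW => K; rewrite sE.
  have y0 : 0 <= (vprod p K)%:R * x by rewrite mulr_ge0.
  have /andP[l u] := truncn_itv y0.
  apply/andP; split; last by rewrite ler_pdivrMr // [leRHS]mulrC.
  rewrite lerBlDr; apply: (@le_trans _ _
    ((Num.truncn ((vprod p K)%:R * x)).+1%:R / (vprod p K)%:R)).
    by rewrite ler_pdivlMr // mulrC ltW.
  rewrite -natr1 mulrDl lerD2l mul1r lef_pV2 ?posrE //.
  by rewrite ler_nat ltn_vprod.
- have := cvgB (cvg_cst x) (@cvg_harmonic R).
  by rewrite subr0; exact.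
- exact: cvg_cst.
Qed.

Definition rademacher (R : realType) (p : nat -> nat) (k : nat) (x : R) : R[i] :=
  let t := 2 * pi * (xdigit p x k)%:R / (p k)%:R in (cos t +i* sin t)%C.

(* The digits of n of rank at least n vanish as soon as all p k >= 2, so the
   product stops at n. *)
Definition vilenkin (R : realType) (p : nat -> nat) (n : nat) (x : R) : R[i] :=
  \prod_(k < n) rademacher p k x ^+ ndigit p n k.

Definition lebesgue01 (R : realType) :
    {measure set (measurableTypeR R) -> \bar R} :=
  mrestr lebesgue_measure (measurable_itv `[0%R, 1%R[).

(* The library's Lnorm applies to extended real functions, hence the modulus. *)
Definition supnorm (R : realType) (f : R -> R[i]) : \bar R :=
  Lnorm (lebesgue01 R) +oo%E (fun x => (Normc.normc (f x))%:E).

Definition sidon (R : realType) (p : nat -> nat) (alpha : R) (A : set nat) :=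
  exists2 C1 : R, 0 < C1 &
    forall (s : {fset nat}) (c : nat -> R[i]), [set` s] `<=` A ->
    let f x := \sum_(n <- s) c n * vilenkin p n x in
    (((\sum_(n <- s) Normc.normc (c n) `^ alpha) `^ alpha^-1)%:E <=
     C1%:E * supnorm f)%E.

(* A `&` firstV p N is the set written A \cap B_N. *)
Definition firstV (p : nat -> nat) (N : nat) : set nat := `I_(vprod p N).

Definition annihilator01 (R : realType) (p : nat -> nat) (A : set nat)
    (N : nat) : set R :=
  [set x : R | 0 <= x < 1 /\
     (forall n, (A `&` firstV p N) n -> vilenkin p n x = 1)].

(* Main.v *)
(** Random signs: with [m] the number of characters involved and
    [L = ln (1 / mu F)], some choice of signs makes the sup norm of the signed
    sum of the [V_n] at most [10 * sqrt (m * L)].  A Hoeffding bound controls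
    each value of the sum; the union bound costs only [1 / mu F] and not the
    number [P_N] of cells, because every vector of values is attained on a coset
    of [F], which has measure [mu F].  The Sidon inequality applied to this sum
    gives [m^(1/alpha) <= 10 C1 sqrt (m L)], which is solved for [m]. *)
From mathcomp Require Import ring lra ess_sup_inf.
Require Import Defs.
Set Implicit Arguments.
Unset Strict Implicit.
Unset Printing Implicit Defensive.

Import Order.TTheory GRing.Theory Num.Theory.
Import numFieldNormedType.Exports.
Local Open Scope classical_set_scope.
Local Open Scope ring_scope.

(** * Exponential moments of random signs *)

Lemma expR_invB_ge (R : realType) (t : R) : t < 1 -> expR t <= (1 - t)^-1.
Proof.
move=> t1; rewrite -[t in expR t]opprK expRN lef_pV2 ?posrE ?expR_gt0 ?subr_gt0//.
exact: expR_ge1Dx.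
Qed.

(** For [t ^+ 2 < 1/2], bounding [expR t] by [(1 - t)^-1] gives the sum [2 / (1 - t ^+ 2)], which is
    at most [2 * (1 + 2 * t ^+ 2)]; otherwise [|t| <= 2 * t ^+ 2] already bounds each term. *)
Lemma cosh_le_gauss (R : realType) (t : R) :
  expR t + expR (- t) <= 2 * expR (2 * t ^+ 2).
Proof.
have [h|h] := ltP (t ^+ 2) 2^-1.
- have t1 : t < 1 by nra.
  have t2 : - t < 1 by nra.
  apply: (le_trans (lerD (expR_invB_ge t1) (expR_invB_ge t2))).
  have -> : (1 - t)^-1 + (1 - - t)^-1 = 2 * (1 - t ^+ 2)^-1.
    field; apply/and3P; split; apply/eqP; nra.
  rewrite ler_pM2l//; apply: (@le_trans _ _ (1 + 2 * t ^+ 2)); last exact: expR_ge1Dx.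
  rewrite -div1r ler_pdivrMr ?subr_gt0; first by have := sqr_ge0 t; nra.
  by apply: lt_trans h _; lra.
- by rewrite mulr_natl mulr2n lerD// ler_expR; nra.
Qed.

(** Independence of the signs: the sum over all sign vectors factors into a product of two-term
    sums, each bounded by [cosh_le_gauss]. *)
Lemma sum_signs_expR (R : realType) (T : finType) (u : T -> R) (lam : R) :
  (forall n, `|u n| <= 1) ->
  \sum_(e : {ffun T -> bool}) expR (lam * \sum_n (-1) ^+ e n * u n) <=
    #|{ffun T -> bool}|%:R * expR (2 * lam ^+ 2 * #|T|%:R).
Proof.
move=> u1.
have -> : \sum_(e : {ffun T -> bool}) expR (lam * \sum_n (-1) ^+ e n * u n) =
    \prod_n (expR (lam * u n) + expR (- (lam * u n))).
  transitivity (\prod_(n : T) \sum_(b : bool) expR (lam * ((-1) ^+ b * u n))).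
    rewrite bigA_distr_bigA; apply: eq_bigr => e _.
    by rewrite mulr_sumr expR_sum.
  apply: eq_bigr => n _; rewrite big_bool/= expr1 expr0 mul1r mulN1r mulrN.
  by rewrite addrC.
rewrite card_ffun card_bool natrX expRM_natr -exprMn -prodr_const.
apply: ler_prod => n _; rewrite addr_ge0 ?expR_ge0//=.
apply: le_trans (cosh_le_gauss _) _; rewrite ler_pM2l// ler_expR exprMn.
have : u n ^+ 2 <= 1 by rewrite -real_normK ?num_real// expr_le1.
have := sqr_ge0 lam; nra.
Qed.

(** Averaging: if every choice of signs exceeded the bound, so would the mean over all choices,
    against [sum_signs_expR] applied at each point of [X]. *)
Lemma exists_signs_expR (R : realType) (T X : finType) (u : X -> T -> R)
    (lam : R) : (forall x n, `|u x n| <= 1) ->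
  exists e : T -> bool,
    \sum_x expR (lam * \sum_n (-1) ^+ e n * u x n) <=
      #|X|%:R * expR (2 * lam ^+ 2 * #|T|%:R).
Proof.
move=> u1; apply: contrapT => /forallNP h.
have : \sum_(e : {ffun T -> bool}) #|X|%:R * expR (2 * lam ^+ 2 * #|T|%:R) <
    \sum_(e : {ffun T -> bool}) \sum_x expR (lam * \sum_n (-1) ^+ e n * u x n).
  apply: ltr_sum => [|e _]; last by rewrite ltNge; apply/negP/h.
  by apply/hasP; exists [ffun=> false]; rewrite ?mem_index_enum.
apply/negP; rewrite -leNgt exchange_big/=.
apply: (@le_trans _ _ (\sum_(x : X)
    #|{ffun T -> bool}|%:R * expR (2 * lam ^+ 2 * #|T|%:R))).
  by apply: ler_sum => x _; exact: sum_signs_expR.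
by rewrite !sumr_const -[leLHS]mulr_natl -[leRHS]mulr_natl mulrCA.
Qed.

(** * Roots of unity and complex moduli *)

Definition proot (R : realType) (q : nat) : R[i] :=
  (cos (2 * pi / q%:R) +i* sin (2 * pi / q%:R))%C.

Lemma proot_exp (R : realType) (q t : nat) :
  proot R q ^+ t =
    (cos (2 * pi * t%:R / q%:R) +i* sin (2 * pi * t%:R / q%:R))%C.
Proof.
elim: t => [|t IH]; first by rewrite expr0 mulr0 mul0r cos0 sin0.
have -> : 2 * pi * t.+1%:R / q%:R = 2 * pi / q%:R + 2 * pi * t%:R / q%:R :> R.
  by rewrite -natr1; ring.
rewrite exprS IH cosD sinD /proot.
by congr Complex; rewrite addrC.
Qed.

Lemma proot_unity (R : realType) (q : nat) : (0 < q)%N -> proot R q ^+ q = 1.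
Proof.
move=> q0; rewrite proot_exp mulfK ?pnatr_eq0 -?lt0n//.
by rewrite mulr_natl cos2pi sin2pi.
Qed.

Lemma normc_proot (R : realType) (q : nat) : Normc.normc (proot R q) = 1.
Proof. by rewrite /Normc.normc/= cos2Dsin2 sqrtr1. Qed.

Lemma normcX (R : realType) (z : R[i]) (n : nat) :
  Normc.normc (z ^+ n) = Normc.normc z ^+ n.
Proof.
elim: n => [|n IH]; first by rewrite !expr0 Normc.normc1.
by rewrite !exprS Normc.normcM IH.
Qed.

Lemma normc_prod (R : realType) (I : finType) (F : I -> R[i]) :
  Normc.normc (\prod_i F i) = \prod_i Normc.normc (F i).
Proof.
by apply: (big_morph _ (@Normc.normcM R)); exact: Normc.normc1.
Qed.

Lemma normc_ge_ReIm (R : realType) (z : R[i]) :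
  `|complex.Re z| <= Normc.normc z /\ `|complex.Im z| <= Normc.normc z.
Proof.
case: z => a b /=; rewrite -!sqrtr_sqr.
by rewrite !ler_wsqrtr ?lerDl ?lerDr ?sqr_ge0.
Qed.

Lemma normc_le_ReIm (R : realType) (z : R[i]) :
  Normc.normc z <= `|complex.Re z| + `|complex.Im z|.
Proof.
case: z => a b /=; rewrite -[leRHS]ger0_norm ?addr_ge0// -sqrtr_sqr.
apply: ler_wsqrtr; rewrite sqrrD !real_normK ?num_real//.
by rewrite addrAC lerDl mulrn_wge0// mulr_ge0.
Qed.

(** * Characters of the finite digit group *)

(** The finite group of the first [N] digits; on the points sharing these digits, every [V_n] with
    [n < vprod p N] is constant. *)
Definition digits (p : nat -> nat) (N : nat) : finType :=
  {dffun forall k : 'I_N, 'I_(p k)}.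

Definition dchar (R : realType) (p : nat -> nat) (N : nat) (d : digits p N)
    (n : nat) : R[i] :=
  \prod_(k < N) (proot R (p k) ^+ d k) ^+ ndigit p n k.

Definition xdigits (R : realType) (p : nat -> nat)
    (p2 : forall k, (2 <= p k)%N) (N : nat) (x : R) : digits p N :=
  [ffun k : 'I_N => Ordinal (xdigit_lt p2 x k)].

Lemma card_digits (p : nat -> nat) (N : nat) : #|digits p N| = vprod p N.
Proof.
rewrite card_dep_ffun /vprod foldrE big_map big_enum/=.
by apply: eq_bigr => k _; rewrite card_ord.
Qed.

Lemma leq_vprod (p : nat -> nat) (p2 : forall k, (2 <= p k)%N) (K L : nat) :
  (K <= L)%N -> (vprod p K <= vprod p L)%N.
Proof.
move=> /subnK <-; elim: (L - K)%N => // m IH.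
by rewrite addSn vprodS (leq_trans IH)// leq_pmulr// ltnW.
Qed.

Lemma prod_ndigit_widen (R : realType) (p : nat -> nat)
    (p2 : forall k, (2 <= p k)%N) (F : nat -> R[i]) (n K L : nat) :
  (n < vprod p K)%N -> (K <= L)%N ->
  \prod_(k < L) F k ^+ ndigit p n k = \prod_(k < K) F k ^+ ndigit p n k.
Proof.
move=> nK /subnK <-; elim: (L - K)%N => // m IH.
rewrite addSn big_ord_recr/= IH /ndigit divn_small ?mod0n ?expr0 ?mulr1//.
by apply: leq_trans nK _; apply: leq_vprod => //; rewrite leq_addl.
Qed.

(** [vilenkin] stops its product at rank [n] and [dchar] at rank [N]; the digits of [n] vanish
    beyond both, so each product equals the one up to [maxn n N]. *)
Lemma vilenkin_dchar (R : realType) (p : nat -> nat)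
    (p2 : forall k, (2 <= p k)%N) (N n : nat) (x : R) :
  (n < vprod p N)%N -> vilenkin p n x = dchar R (xdigits p2 N x) n.
Proof.
move=> nN.
have -> : dchar R (xdigits p2 N x) n =
    \prod_(k < N) rademacher p k x ^+ ndigit p n k.
  by apply: eq_bigr => k _; rewrite ffunE/= /rademacher proot_exp.
pose F k := rademacher p k x.
rewrite -[RHS](prod_ndigit_widen p2 F nN (leq_maxr n N)).
by rewrite -[LHS](prod_ndigit_widen p2 F (ltn_vprod p2 n) (leq_maxl n N)).
Qed.

Lemma normc_dchar (R : realType) (p : nat -> nat) (N : nat) (d : digits p N)
  (n : nat) : Normc.normc (dchar R d n) = 1.
Proof.
rewrite normc_prod big1// => k _.
by rewrite !normcX normc_proot !expr1n.
Qed.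

(** The group law has no carries, which makes each [dchar] multiplicative. *)
Definition addd (p : nat -> nat) (p2 : forall k, (2 <= p k)%N) (N : nat)
    (c d : digits p N) : digits p N :=
  [ffun k : 'I_N => Ordinal (ltn_pmod (c k + d k) (ltnW (p2 k)))].

Lemma dchar_addd (R : realType) (p : nat -> nat) (p2 : forall k, (2 <= p k)%N)
    (N : nat) (c d : digits p N) (n : nat) :
  dchar R (addd p2 c d) n = dchar R c n * dchar R d n.
Proof.
rewrite -big_split; apply: eq_bigr => k _ /=; rewrite ffunE/= -exprMn -exprD.
by rewrite expr_mod// proot_unity// ltnW.
Qed.

Lemma addd_inj (p : nat -> nat) (p2 : forall k, (2 <= p k)%N) (N : nat)
  (c : digits p N) : injective (addd p2 c).
Proof.
move=> d d' /ffunP h; apply/ffunP => k; apply: val_inj => /=.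
have := h k; rewrite !ffunE => /(congr1 val)/= /eqP.
by rewrite eqn_modDl !modn_small// => /eqP.
Qed.

Definition dann (R : realType) (p : nat -> nat) (N : nat) (s : seq nat) :
    {set digits p N} :=
  [set d | all (fun n => dchar R d n == 1) s]%SET.

(** The coset of [dann] through [c], described by the values of the characters. *)
Definition dfiber (R : realType) (p : nat -> nat) (N : nat) (s : seq nat)
    (c : digits p N) : {set digits p N} :=
  [set d | all (fun n => dchar R d n == dchar R c n) s]%SET.

(** Translation by [c] is injective and carries [dann] into the fiber of [c]. *)
Lemma card_dann_fiber (R : realType) (p : nat -> nat)
    (p2 : forall k, (2 <= p k)%N) (N : nat) (s : seq nat) (c : digits p N) :
  (#|dann R p N s| <= #|dfiber R s c|)%N.
Proof.
rewrite -(card_imset _ (addd_inj (p2 := p2) (c := c))); apply: subset_leq_card.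
apply/fintype.subsetP => _ /imsetP[d + ->]; rewrite !inE => /allP h.
by apply/allP => n /h /eqP dn; rewrite dchar_addd dn mulr1.
Qed.

(** * Digit cells and the measure of the annihilator *)

(* The integer part of [vprod p N * x] when [d] is the digit sequence of [x]. *)
Fixpoint digits_num (p : nat -> nat) (d : nat -> nat) (N : nat) : nat :=
  if N is M.+1 then (digits_num p d M * p M + d M)%N else 0%N.

Lemma truncn_vprodS (R : realType) (p : nat -> nat)
    (p2 : forall k, (2 <= p k)%N) (x : R) (x0 : 0 <= x) (K : nat) :
  Num.truncn ((vprod p K.+1)%:R * x) =
    (Num.truncn ((vprod p K)%:R * x) * p K + xdigit p x K)%N.
Proof.
rewrite /xdigit; set t := Num.truncn ((vprod p K.+1)%:R * x).
suff -> : Num.truncn ((vprod p K)%:R * x) = (t %/ p K)%N by rewrite -divn_eq.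
have pK : (0 < p K)%N by exact: ltnW.
have pR : 0 < (p K)%:R :> R by rewrite ltr0n.
have y0 : 0 <= (vprod p K.+1)%:R * x by rewrite mulr_ge0.
have := truncn_itv y0; rewrite -/t => /andP[l u].
have e : (vprod p K.+1)%:R * x = (p K)%:R * ((vprod p K)%:R * x).
  by rewrite vprodS natrM mulrA (mulrC (p K)%:R).
apply: truncn_def; rewrite -(ler_pM2l pR) -(ltr_pM2l pR) -e -!natrM.
apply/andP; split; first by apply: le_trans l; rewrite ler_nat mulnC leq_divM.
by apply: lt_le_trans u _; rewrite ler_nat mulnC ltn_ceil.
Qed.

(** Uniqueness of mixed-radix expansions: reduction modulo [p N] recovers the last digit, and
    cancelling it leaves the induction hypothesis. *)
Lemma xdigit_eqP (R : realType) (p : nat -> nat) (p2 : forall k, (2 <= p k)%N)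
    (x : R) (x01 : 0 <= x < 1) (d : nat -> nat) (N : nat) :
  (forall k, (k < N)%N -> (d k < p k)%N) ->
  (forall k, (k < N)%N -> xdigit p x k = d k) <->
  Num.truncn ((vprod p N)%:R * x) = digits_num p d N.
Proof.
have /andP[x0 x1] := x01.
elim: N => [|N IH] dp.
  by rewrite /vprod big_ord0 mul1r (truncn_def (n := 0%N)).
have {IH} IH := IH (fun k kN => dp k (ltnW kN)).
rewrite truncn_vprodS//=; split => [h|h].
  by rewrite h// (IH.1 (fun k kN => h k (ltnW kN))).
have e : xdigit p x N = d N.
  move/(congr1 (modn^~ (p N))): h.
  by rewrite !modnMDl !modn_small ?dp// xdigit_lt.
move: h; rewrite e => /eqP; rewrite eqn_add2r eqn_pmul2r ?(ltnW (p2 N))// => /eqP h k.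
by rewrite ltnS leq_eqVlt => /orP[/eqP->//|]; apply: IH.2.
Qed.

Lemma digits_num_lt (p d : nat -> nat) (N : nat) :
  (forall k, (k < N)%N -> (d k < p k)%N) -> (digits_num p d N < vprod p N)%N.
Proof.
elim: N => [|N IH] dp /=; first by rewrite /vprod big_ord0.
apply: (@leq_trans ((digits_num p d N).+1 * p N)).
  by rewrite mulSn addnC ltn_add2r dp.
by rewrite vprodS leq_mul2r (IH (fun k kN => dp k (ltnW kN))) orbT.
Qed.

Definition cell (R : realType) (p : nat -> nat) (N : nat) (d : digits p N) :
    set R :=
  [set x | 0 <= x < 1 /\ forall k : 'I_N, xdigit p x k = d k].
Arguments cell R {p N} d _.

Lemma cell_itv (R : realType) (p : nat -> nat) (p2 : forall k, (2 <= p k)%N)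
    (N : nat) (d : digits p N) :
  exists t : nat,
    cell R d = `[t%:R / (vprod p N)%:R, t.+1%:R / (vprod p N)%:R[%classic.
Proof.
(* [digits_num] takes a digit function on all of [nat], so [d] is extended by 0 from rank [N] on. *)
pose d' k := if insub k is Some i then nat_of_ord (d i) else 0%N.
have d'E (k : 'I_N) : d' k = d k by rewrite /d' valK.
have d'p k : (k < N)%N -> (d' k < p k)%N.
  by move=> kN; rewrite (d'E (Ordinal kN)).
have P0 : 0 < (vprod p N)%:R :> R by rewrite ltr0n vprod_gt0.
exists (digits_num p d' N); apply/seteqP; split => x; rewrite /cell /= in_itv/=.
  move=> [x01 h]; rewrite ler_pdivrMr// ltr_pdivlMr// mulrC.
  rewrite -((xdigit_eqP p2 x01 d'p).1 _).
    by apply: truncn_itv; have /andP[x0 _] := x01; rewrite mulr_ge0.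
  by move=> k kN; rewrite (h (Ordinal kN)) -d'E.
rewrite ler_pdivrMr// ltr_pdivlMr// mulrC => /andP[l u].
have x01 : 0 <= x < 1.
  rewrite -(pmulr_rge0 _ P0) (le_trans _ l)//= -(ltr_pM2l P0) mulr1.
  by rewrite (lt_le_trans u)// ler_nat digits_num_lt.
split=> // k; rewrite -d'E; apply: (xdigit_eqP p2 x01 d'p).2 => //.
by apply: truncn_def; rewrite l u.
Qed.

Lemma measurable_cell (R : realType) (p : nat -> nat)
    (p2 : forall k, (2 <= p k)%N) (N : nat) (d : digits p N) :
  measurable (cell R d : set (measurableTypeR R)).
Proof. by have [t ->] := cell_itv R p2 d; exact: measurable_itv. Qed.

Lemma lebesgue_measure_cell (R : realType) (p : nat -> nat)
    (p2 : forall k, (2 <= p k)%N) (N : nat) (d : digits p N) :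
  lebesgue_measure (cell R d) = ((vprod p N)%:R^-1)%:E.
Proof.
have [t ->] := cell_itv R p2 d; rewrite lebesgue_measure_itv/= lte_fin.
have P0 : 0 < (vprod p N)%:R^-1 :> R by rewrite invr_gt0 ltr0n vprod_gt0.
rewrite ltr_pM2r// ltr_nat ltnSn -EFinB -mulrBl -natr1.
by rewrite addrAC subrr add0r mul1r.
Qed.

(** Membership in the annihilator depends only on the first [N] digits of [x], through
    [vilenkin_dchar]. *)
Lemma annihilator01E (R : realType) (p : nat -> nat)
    (p2 : forall k, (2 <= p k)%N) (A : set nat) (N : nat) (s : seq nat) :
  (forall n, (A `&` firstV p N) n <-> n \in s) ->
  annihilator01 p A N = \big[setU/set0]_(d in dann R p N s) cell R d.
Proof.
move=> sE.
have lt n : n \in s -> (n < vprod p N)%N by move=> /sE[].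
rewrite -bigcup_seq_cond; apply/seteqP; split => x.
  move=> [x01 h]; exists (xdigits p2 N x).
    rewrite /= mem_index_enum inE; apply/allP => n ns.
    by rewrite -vilenkin_dchar ?lt// h//; exact/sE.
  by split=> // k; rewrite ffunE.
move=> [d /andP[_]]; rewrite inE => /allP h [x01 xd].
split=> // n /sE ns; rewrite (vilenkin_dchar p2 _ (lt _ ns)).
suff -> : xdigits p2 N x = d by apply/eqP/h.
by apply/ffunP => k; apply: val_inj; rewrite ffunE /= xd.
Qed.

Lemma measure_bigsetU_le (d : measure_display) (T : measurableType d)
    (R : realType) (mu : {measure set T -> \bar R}) (I : finType)
    (P : {pred I}) (F : I -> set T) :
  (forall i, measurable (F i)) ->
  (mu (\big[setU/set0]_(i in P) F i) <= \sum_(i in P) mu (F i))%E.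
Proof.
move=> mF; apply: (proj2 (A := measurable (\big[setU/set0]_(i in P) F i))).
apply: (big_ind2 (fun X r => measurable X /\ (mu X <= r)%E)).
- by rewrite measure0; split.
- move=> X r Y s [mX Xr] [mY Ys]; split; first exact: measurableU.
  by rewrite (le_trans (measureU2 _ mX mY))// leeD.
- by move=> i _; split.
Qed.

(** Subadditivity over the cells suffices; the bound is later read as
    [vprod p N <= #|dann| / mu F]. *)
Lemma measure_annihilator01_le (R : realType) (p : nat -> nat)
    (p2 : forall k, (2 <= p k)%N) (A : set nat) (N : nat) (s : seq nat) :
  (forall n, (A `&` firstV p N) n <-> n \in s) ->
  (lebesgue_measure (annihilator01 (R := R) p A N) <=
    (#|dann R p N s|%:R / (vprod p N)%:R)%:E)%E.
Proof.
move=> sE; rewrite (annihilator01E R p2 sE).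
apply: le_trans (measure_bigsetU_le _ _ _) _; first by move=> d; exact: measurable_cell.
rewrite (eq_bigr (fun=> ((vprod p N)%:R^-1)%:E)); last first.
  by move=> d _; exact: lebesgue_measure_cell.
by rewrite sumEFin sumr_const mulr_natl.
Qed.

(** The cell of the zero digit vector, where all characters equal 1, lies in the annihilator. *)
Lemma measure_annihilator01_gt0 (R : realType) (p : nat -> nat)
    (p2 : forall k, (2 <= p k)%N) (A : set nat) (N : nat) (s : seq nat) :
  (forall n, (A `&` firstV p N) n <-> n \in s) ->
  (0 < lebesgue_measure (annihilator01 (R := R) p A N))%E.
Proof.
move=> sE; rewrite (annihilator01E R p2 sE).
pose d0 : digits p N := [ffun k : 'I_N => Ordinal (ltnW (p2 k))].
have d0s : d0 \in dann R p N s.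
  rewrite inE; apply/allP => n _; apply/eqP; apply: big1 => k _.
  by rewrite ffunE/= expr1n.
apply: (@lt_le_trans _ _ (lebesgue_measure (cell R d0))).
  by rewrite lebesgue_measure_cell// lte_fin invr_gt0 ltr0n vprod_gt0.
apply: le_measure; rewrite ?inE.
- exact: measurable_cell.
- by apply: bigsetU_measurable => d _; exact: measurable_cell.
- by rewrite (bigD1 d0)//=; exact: subsetUl.
Qed.

(** * The annihilator of a nontrivial character fills at most half of the group *)

(** With [y = pi * t / q] strictly between 0 and [pi], [cos (2 y) = 1] would force [sin y = 0]. *)
Lemma proot_exp_neq1 (R : realType) (q t : nat) :
  (0 < t < q)%N -> proot R q ^+ t != 1.
Proof.
move=> /andP[t0 tq]; have q0 : (0 < q)%N by apply: leq_trans tq.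
apply/eqP; rewrite proot_exp => -[h _].
pose y : R := pi * t%:R / q%:R.
have e : 2 * pi * t%:R / q%:R = y *+ 2 by rewrite /y; ring.
have qR : 0 < q%:R :> R by rewrite ltr0n.
have y0 : 0 < y by rewrite !mulr_gt0 ?pi_gt0 ?ltr0n ?invr_gt0.
have ypi : y < pi by rewrite ltr_pdivrMr// ltr_pM2l ?pi_gt0// ltr_nat.
have s0 : 0 < sin y by apply: sin_gt0_pi; rewrite y0.
move: h; rewrite e cos_mulr2n => h; have := cos2Dsin2 y; nra.
Qed.

Lemma exists_dchar_neq1 (R : realType) (p : nat -> nat)
    (p2 : forall k, (2 <= p k)%N) (N n : nat) :
  (0 < n < vprod p N)%N -> exists d : digits p N, dchar R d n != 1.
Proof.
move=> /andP[n0 nN].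
have [k nk] : exists k : 'I_N, ndigit p n k != 0%N.
  apply: contrapT => /forallNP h; move: n0; rewrite (ndigit_sum p2 n) lt0n.
  rewrite big1 ?eqxx// => k _; have [kN|Nk] := ltnP k N.
    by have /negP := h (Ordinal kN); rewrite negbK => /eqP /= ->.
  by rewrite /ndigit divn_small ?mod0n// (leq_trans nN)// leq_vprod.
(* The unit vector at a rank [k] where [n] has a nonzero digit. *)
exists [ffun j : 'I_N => Ordinal (ltn_pmod (j == k) (ltnW (p2 j)))].
rewrite /dchar (bigD1 k)//= big1 ?mulr1 => [|j jk]; rewrite ffunE/=.
  rewrite eqxx modn_small// expr1 proot_exp_neq1//.
  by rewrite lt0n nk /ndigit ltn_pmod// ltnW.
by rewrite (negbTE jk) mod0n expr0 expr1n.
Qed.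

(** A fiber through a point where [V_n] differs from 1 is disjoint from [dann] and at least as
    large. This yields [2 <= expR L] in the theorem. *)
Lemma card_dann_double (R : realType) (p : nat -> nat)
    (p2 : forall k, (2 <= p k)%N) (N n : nat) (s : seq nat) :
  n \in s -> (0 < n < vprod p N)%N -> (2 * #|dann R p N s| <= vprod p N)%N.
Proof.
move=> ns nN; have [c cn] := exists_dchar_neq1 R p2 nN.
rewrite -card_digits mul2n -addnn.
apply: leq_trans (leq_add (leqnn _) (card_dann_fiber R p2 s c)) _.
rewrite -cardsUI disjoint_setI0 ?cards0 ?addn0 ?max_card//.
rewrite -setI_eq0; apply/eqP/setP => d; rewrite !inE; apply/negbTE/negP.
move=> /andP[/allP/(_ n ns)/eqP dn /allP/(_ n ns)].
by rewrite dn eq_sym (negbTE cn).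
Qed.

(** * Signs giving a small sup norm *)

Lemma exists_signs_normc (R : realType) (p : nat -> nat)
    (p2 : forall k, (2 <= p k)%N) (N : nat) (s : {fset nat}) (L : R) :
  (0 < #|` s|)%N -> 2 <= expR L ->
  (vprod p N)%:R <= expR L * #|dann R p N s|%:R ->
  exists c : nat -> R[i], (forall n, Normc.normc (c n) = 1) /\
    forall d : digits p N, Normc.normc (\sum_(n <- s) c n * dchar R d n) <=
      10 * Num.sqrt (#|` s|%:R * L).
Proof.
move=> m0 L2 hL.
have L0 : 0 < L by rewrite -expR_gt1; apply: lt_le_trans L2; rewrite ltr1n.
pose m : R := #|` s|%:R.
have mR : 0 < m by rewrite ltr0n.
pose w := Num.sqrt (m * L).
have w0 : 0 < w by rewrite sqrtr_gt0 mulr_gt0.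
have w2 : w ^+ 2 = m * L by rewrite sqr_sqrtr// mulr_ge0// ltW.
(* This choice makes both [lam * w] and [lam ^+ 2 * m] equal to [L]. *)
pose lam := L / w.
have lam0 : 0 < lam by rewrite divr_gt0.
have lamm : lam ^+ 2 * m = L.
  by rewrite expr_div_n w2; field; rewrite !gt_eqF.
pose part (b : bool) (z : R[i]) := if b then complex.Re z else complex.Im z.
(* The union bound runs over each digit vector and four real functionals: plus or minus (first
   boolean) the real or imaginary part (second boolean). *)
pose u (x : digits p N * (bool * bool)) (n : s) : R :=
  (-1) ^+ x.2.1 * part x.2.2 (dchar R x.1 (val n)).
have u1 x n : `|u x n| <= 1.
  rewrite normrM normrX normrN1 expr1n mul1r -(normc_dchar R x.1 (val n)).
  have [hRe hIm] := normc_ge_ReIm (dchar R x.1 (val n)).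
  by rewrite /part; case: ifP.
have [e he] := exists_signs_expR lam u1.
(* The sign is +1 outside [s]. *)
pose sg n : R := (-1) ^+ oapp e false (insub n).
pose c n : R[i] := (sg n)%:C%C.
exists c; split=> [n|d].
  by rewrite /Normc.normc/= expr0n addr0 sqrtr_sqr normrX normrN1 expr1n.
set z := \sum_(n <- s) _.
pose S x := \sum_n (-1) ^+ e n * u x n.
have partZ b r z' : part b (r%:C%C * z') = r * part b z'.
  by case: z' => x y; case: b; rewrite /= mul0r ?subr0 ?addr0.
have partE b d' : part b (\sum_(n <- s) c n * dchar R d' n) =
    \sum_(n <- s) sg n * part b (dchar R d' n).
  have h1 x y : part b (x + y) = part b x + part b y.
    by case: b; case: x => ? ?; case: y.
  have h0 : part b 0 = 0 by rewrite /part; case: ifP.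
  rewrite (big_morph (part b) h1 h0); apply: eq_bigr => n _; rewrite /c.
  exact: partZ.
have SE d' b b' : S (d', (b, b')) =
    (-1) ^+ b * part b' (\sum_(n <- s) c n * dchar R d' n).
  rewrite partE mulr_sumr big_seq_fsetE/=; apply: eq_bigr => n _.
  by rewrite /u/= /sg valK/= mulrCA.
have bound b b' : S (d, (b, b')) <= 5 * w.
  set q := (b, b').
  (* Exponential Markov argument: the claim becomes [expR (lam * S (d, q)) <= expR (5 * L)], and
     both sides are then multiplied by the size of [dann]. *)
  rewrite -(ler_pM2l lam0) mulrCA [lam * w]divfK ?gt_eqF// -ler_expR.
  set G := dann R p N s in hL.
  have G0 : 0 < #|G|%:R :> R.
    rewrite lt_neqAle eq_sym ler0n andbT; apply/eqP => G0; move: hL.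
    by rewrite G0 mulr0 lern0 -leqn0 leqNgt vprod_gt0.
  rewrite -(ler_pM2r G0).
  pose fib := dfiber R s d.
  (* [S] is constant on the fiber of [d], so the value at [d] occurs at least [#|G|] times in the
     sum over all points. *)
  have Sfib d' : d' \in fib -> S (d', q) = S (d, q).
    rewrite inE => /allP h; rewrite !SE; congr (_ * part _ _).
    by rewrite !big_seq; apply: eq_bigr => n ns; rewrite (eqP (h n ns)).
  apply: (@le_trans _ _ (expR (lam * S (d, q)) * #|fib|%:R)).
    by rewrite ler_pM2l ?expR_gt0// ler_nat card_dann_fiber.
  have -> : expR (lam * S (d, q)) * #|fib|%:R =
      \sum_(d' in fib) expR (lam * S (d', q)).
    rewrite mulr_natr -sumr_const.
    by apply: eq_bigr => d' /Sfib ->.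
  apply: (@le_trans _ _ (\sum_x expR (lam * S x))).
    rewrite -(pair_bigA _ (fun d' q' => expR (lam * S (d', q'))))/=.
    rewrite big_mkcond; apply: ler_sum => d' _.
    rewrite (bigD1 q)//=; have h0 : 0 <= \sum_(i | i != q) expR (lam * S (d', i)).
      by apply: sumr_ge0 => i _; exact: expR_ge0.
    by case: ifP => _; rewrite ?lerDl// addr_ge0// expR_ge0.
  apply: le_trans he _.
  rewrite -cardfE -mulrA lamm !card_prod card_bool card_digits natrM.
  (* The five factors [expR L]: two absorb the 4 functionals, two come from the moment bound, and
     one from [vprod p N <= expR L * #|G|]. *)
  have -> : expR (5 * L) = expR L ^+ 2 * expR (2 * L) * expR L.
    by rewrite -expRM_natl -!expRD; congr expR; ring.
  have E4 : 4 <= expR L ^+ 2 by nra.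
  have := ler_pM (ler0n _ _) (ler0n _ _) hL E4.
  rewrite -(ler_pM2r (expR_gt0 (2 * L))) => /le_trans; apply.
  by rewrite le_eqVlt; apply/orP; left; apply/eqP; ring.
apply: le_trans (normc_le_ReIm _) _.
have absle x : (forall b : bool, (-1) ^+ b * x <= 5 * w) -> `|x| <= 5 * w.
  move=> h; rewrite ler_norml lerNl.
  by have := h false; have := h true; rewrite expr0 expr1 mul1r mulN1r => -> ->.
have -> : 10 * w = 5 * w + 5 * w by ring.
by apply: lerD; apply: absle => b; [have := bound b true | have := bound b false];
  rewrite SE.
Qed.

(** * The Sidon inequality and the conclusion *)

Lemma supnorm_le (R : realType) (f : R -> R[i]) (B : R) :
  0 <= B -> (forall x, Normc.normc (f x) <= B) -> (supnorm f <= B%:E)%E.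
Proof.
move=> B0 fB; rewrite /supnorm unlock; case: ifP => _; last by rewrite lee_fin.
apply/ess_supP; apply: aeW => x /=; rewrite lee_fin ger0_norm ?fB//.
by case: (f x) => a b; exact: sqrtr_ge0.
Qed.

Theorem theorem4 (R : realType) (p : nat -> nat) (p2 : forall k, (2 <= p k)%N)
    (A : set nat) (alpha : R) (alpha1 : 1 <= alpha) (alpha2 : alpha < 2)
    (HA : sidon p alpha A) :
  exists2 C : R, 0 < C &
    forall (A' : set nat) (N : nat),
      A' `<=` A -> A' !=set0 -> (0 < N)%N ->
      A' `&` firstV p N <> [set 0%N] ->
      (#|` fset_set (A' `&` firstV p N)|)%:R <=
      C * (ln (1 / fine (lebesgue_measure (annihilator01 p A' N))))
            `^ (alpha / (2 - alpha)).
Proof.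
case: HA => C1 C10 HA.
have a0 : 0 < alpha by apply: lt_le_trans alpha1.
pose b := alpha / (2 - alpha).
have b0 : 0 < b by rewrite divr_gt0// subr_gt0.
(* The final inequality is [key] raised to the power [2 * b], where [2 * b / alpha = 1 + b]. *)
exists ((10 * C1) `^ (2 * b)); first by rewrite powR_gt0// mulr_gt0.
move=> A' N A'A _ _ S0.
have finS : finite_set (A' `&` firstV p N).
  by apply: sub_finite_set (finite_II (vprod p N)) => n [].
set s := fset_set _.
have sE n : (A' `&` firstV p N) n <-> n \in s.
  by rewrite in_fset_set// inE.
have [->|s0] := posnP #|` s|; first by rewrite mulr_ge0// powR_ge0.
(* A nontrivial character is needed to keep [L] away from 0: for the set [{0}] the annihilator is
   all of [[0,1)] and the logarithm vanishes. *)
have [n ns n0] : exists2 n, n \in s & (0 < n)%N.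
  apply: contrapT => h; apply: S0; apply/seteqP; split => k.
    by move/sE => ks; apply/eqP; apply/negPn/negP; rewrite -lt0n => k0; apply: h; exists k.
  move=> ->; move: s0; rewrite cardfs_gt0 => /fset0Pn[j js]; apply/sE.
  suff <- : j = 0%N by [].
  by apply/eqP; apply/negPn/negP; rewrite -lt0n => j0; apply: h; exists j.
have nN : (0 < n < vprod p N)%N by rewrite n0; have /sE[] := ns.
pose mu := lebesgue_measure (annihilator01 (R := R) p A' N).
have mu_gt0 : (0 < mu)%E := measure_annihilator01_gt0 R p2 sE.
have mu_le := measure_annihilator01_le R p2 sE.
rewrite -/mu in mu_le *.
have muE : mu = (fine mu)%:E.
  by rewrite fineK// ge0_fin_numE ?(ltW mu_gt0)// (le_lt_trans mu_le) ?ltry.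
move: mu_gt0 mu_le; rewrite muE lte_fin lee_fin /=.
set v := fine mu => v0 v_le.
have P0 : 0 < (vprod p N)%:R :> R by rewrite ltr0n vprod_gt0.
rewrite ler_pdivlMr// in v_le.
set L := ln (1 / v).
have expL : expR L = v^-1 by rewrite lnK ?div1r// posrE invr_gt0.
have L2 : 2 <= expR L.
  rewrite expL -[2]invrK lef_pV2 ?posrE ?invr_gt0//.
  rewrite -(ler_pM2r P0) (le_trans v_le)// mulrC ler_pdivlMr// mulrC -natrM.
  by rewrite ler_nat (card_dann_double R p2 ns nN).
have hL : (vprod p N)%:R <= expR L * #|dann R p N s|%:R.
  by rewrite expL mulrC ler_pdivlMr// mulrC.
have L0 : 0 < L by rewrite -expR_gt1; apply: lt_le_trans L2; rewrite ltr1n.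
have [c [c1 hc]] := exists_signs_normc p2 s0 L2 hL.
have sA : [set` s] `<=` A by move=> k /sE[/A'A].
set m : R := #|` s|%:R in hc *.
have m0 : 0 < m by rewrite ltr0n.
(* The coefficients have modulus 1, so the left side of the Sidon inequality is exactly [m] to the
   power [1/alpha]. *)
have key : m `^ alpha^-1 <= 10 * C1 * (m * L) `^ 2^-1.
  have := HA s c sA => /=.
  under eq_bigr do rewrite c1 powR1.
  have -> : \sum_(i <- s) (1 : R) = m by rewrite big_const_seq count_predT iter_addr_0.
  move=> h; rewrite -lee_fin; apply: le_trans h _.
  rewrite (mulrC 10) -mulrA EFinM lee_pmul2l ?lte_fin//.
  apply: supnorm_le => [|x]; first by rewrite mulr_ge0// powR_ge0.
  rewrite powR12_sqrt; last by rewrite mulr_ge0 ?ltW.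
  apply: le_trans (hc (xdigits p2 N x)); rewrite le_eqVlt; apply/orP; left.
  apply/eqP; congr Normc.normc; rewrite !big_seq; apply: eq_bigr => k /sE[_ kN].
  by rewrite (vilenkin_dchar p2 _ kN).
have [m0' L0'] := (ltW m0, ltW L0).
have mL0 : 0 <= m * L by rewrite mulr_ge0.
have C0 : 0 <= 10 * C1 by rewrite mulr_ge0// ltW.
have mb0 : 0 < m `^ b by rewrite powR_gt0.
(* Multiplying by the [b]-th power of [m] turns both sides into powers with exponent [2 * b] of the
   sides of [key]. *)
rewrite -/b -(ler_pM2l mb0) mulrCA -powRM//.
have -> : m `^ b * m = (m `^ alpha^-1) `^ (2 * b).
  rewrite -[X in _ * X](powRr1 m0') -powRD ?(gt_eqF m0) ?implybT// -powRrM.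
  by congr powR; rewrite /b; field; rewrite !gt_eqF ?subr_gt0.
have -> : (m * L) `^ b = ((m * L) `^ 2^-1) `^ (2 * b).
  by rewrite -powRrM mulrA mulVf ?mul1r.
rewrite -powRM ?powR_ge0//.
apply: ge0_ler_powR; rewrite ?nnegrE ?powR_ge0//.
  by rewrite mulr_ge0// ltW.
by rewrite mulr_ge0// powR_ge0.
Qed.
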